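(* Let $d\in\{1,2\}$. Assume that $\overline{U}_{i}\in\mathcal G$ for all $i\in\mathbb Z^d$, and that for every $i$ and every $\ell=1,\dots,d$ the numerical viscosity coefficients satisfy $$\alpha_{i+\frac12e_\ell}\geqslant\max\{\varrho_\ell(\overline U_i),\varrho_\ell(\overline U_{i+e_\ell})\},\qquad \beta_{i+\frac12e_\ell}>\max\{b_\ell(\overline U_i,S_i),b_\ell(\overline U_{i+e_\ell},S_{i+e_\ell})\}.$$ Put $\lambda_{i+\frac12e_\ell}=\alpha_{i+\frac12e_\ell}+\beta_{i+\frac12e_\ell}$, and let $\Delta t>0$ satisfy $$\Delta t\leqslant\min_{1\leqslant\ell\leqslant d}\frac{\Delta x_\ell}{2d\max_{i}\{\lambda_{i+\frac12e_\ell}\}}.$$ Then, for all $i$ and all $\ell=1,\dots,d$, the intermediate states $$U^{L,+}_{\ell,i}=\overline U_i-2d\,r_\ell\left(\widehat F^L_{i+\frac12e_\ell}-F_{\ell,i}\right),\qquad U^{L,-}_{\ell,i}=\overline U_i-2d\,r_\ell\left(F_{\ell,i}-\widehat F^L_{i-\frac12e_\ell}\right),\qquad r_\ell=\frac{\Delta t}{\Delta x_\ell},$$ belong to $\mathcal G$.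
   Context: **States.** $U=(\rho,\rho\mathbf u,E)^\top\in\mathbb R^{d+2}$ with $\mathbf u=(u_1,\dots,u_d)$, $E=\rho e+\frac12\rho\|\mathbf u\|^2$, $p=(\gamma-1)\rho e$, $\gamma>1$, $T=p/\rho$, $c=\sqrt{\gamma p/\rho}$, $\varrho_\ell(U)=|u_\ell|+c$. The admissible set is $\mathcal G=\{U:\rho>0,\ p=(\gamma-1)(E-\frac{\|\rho\mathbf u\|^2}{2\rho})>0\}$. $e_\ell$ denotes the $\ell$-th unit vector (not to be confused with the specific internal energy $e$). **Fluxes.** $F^c_\ell(U)=(\rho u_\ell,\ \rho\mathbf u u_\ell+p\,e_\ell,\ (E+p)u_\ell)^\top$. Let $Z=(0,\mathbf u,T)^\top$ and let $S$ denote an approximation of $\nabla Z$, i.e. it contains an approximation $G\in\mathbb R^{d\times d}$ of $\nabla\mathbf u$ and $g\in\mathbb R^d$ of $\nabla T$. From $S$ form $\tau=\mu(G+G^\top-\frac23(\mathrm{tr}\,G)I_d)$ and $q=-\kappa g$, where $\mu>0$, $\kappa=\frac{\gamma\mu}{(\gamma-1)\Pr}$, $\Pr>0$ are constants; put $\tau_\ell=\tau e_\ell$, $q_\ell=q\cdot e_\ell$, $F^v_\ell(U,S)=(0,\ \tau_\ell,\ \mathbf u\cdot\tau_\ell-q_\ell)^\top$ and $$b_\ell(U,S)=\frac{\sqrt{\rho^2q_\ell^2+2\rho^2e\|\tau_\ell\|^2}+\rho|q_\ell|}{2\rho^2e}.$$ **Low-order scheme.** On a uniform Cartesian mesh with cell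 sizes $\Delta x_1,\dots,\Delta x_d$ and cells indexed by $i\in\mathbb Z^d$ (finite meshes being extended e.g. periodically), $\overline U_i$ are the cell averages and $S_i$ is the central difference of the values $Z(\overline U_i)$, i.e. its part for direction $m$ is $(Z(\overline U_{i+e_m})-Z(\overline U_{i-e_m}))/(2\Delta x_m)$. Put $F_{\ell,i}=F^c_\ell(\overline U_i)-F^v_\ell(\overline U_i,S_i)$ and $$\widehat F^L_{i+\frac12e_\ell}=\tfrac12(F_{\ell,i}+F_{\ell,i+e_\ell})-\tfrac{\lambda_{i+\frac12e_\ell}}2(\overline U_{i+e_\ell}-\overline U_i).$$ *)

(* Defs.v *)
From HB Require Import structures.
From mathcomp Require Import all_boot all_order all_algebra.
From mathcomp Require Import all_classical reals.
From mathcomp Require Import ring.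

Set Implicit Arguments.
Unset Strict Implicit.
Unset Printing Implicit Defensive.

Import Order.TTheory GRing.Theory Num.Theory.

Local Open Scope classical_set_scope.
Local Open Scope ring_scope.

(* Vectors of R^(d+2), with blocks of sizes 1, d and 1. *)
Notation state R d := ('cV[R]_(1 + (d + 1))).

Definition mkstate (R : realType) (d : nat) (a : R) (v : 'cV[R]_d) (b : R) :
  state R d := col_mx a%:M (col_mx v b%:M).

Definition dot (R : realType) (d : nat) (v w : 'cV[R]_d) : R :=
  \sum_(k < d) v k 0 * w k 0.

Definition sqnorm (R : realType) (d : nat) (v : 'cV[R]_d) : R := dot v v.

Definition rho (R : realType) (d : nat) (U : state R d) : R := usubmx U 0 0.

Definition momentum (R : realType) (d : nat) (U : state R d) : 'cV[R]_d :=
  usubmx (dsubmx U).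

Definition energy (R : realType) (d : nat) (U : state R d) : R :=
  dsubmx (dsubmx U) 0 0.

Definition velocity (R : realType) (d : nat) (U : state R d) : 'cV[R]_d :=
  (rho U)^-1 *: momentum U.

(* Solves E = rho e + rho |u|^2 / 2 for e. *)
Definition internal_energy (R : realType) (d : nat) (U : state R d) : R :=
  (energy U - rho U * sqnorm (velocity U) / 2) / rho U.

Definition pressure (R : realType) (d : nat) (gamma : R) (U : state R d) : R :=
  (gamma - 1) * (energy U - sqnorm (momentum U) / (2 * rho U)).

Lemma pressureE (R : realType) (d : nat) (gamma : R) (U : state R d) :
  rho U != 0 ->
  pressure gamma U = (gamma - 1) * (rho U * internal_energy U).
Proof.
move=> r0; rewrite /pressure /internal_energy.
have -> : sqnorm (velocity U) = (rho U)^-1 ^+ 2 * sqnorm (momentum U).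
  rewrite /sqnorm /dot mulr_sumr; apply: eq_bigr => k _.
  by rewrite !mxE expr2 mulrACA.
by field.
Qed.

Definition temperature (R : realType) (d : nat) (gamma : R) (U : state R d) :
  R := pressure gamma U / rho U.

Definition sound_speed (R : realType) (d : nat) (gamma : R) (U : state R d) :
  R := Num.sqrt (gamma * pressure gamma U / rho U).

Definition wave_speed (R : realType) (d : nat) (gamma : R) (l : 'I_d)
    (U : state R d) : R :=
  `|velocity U l 0| + sound_speed gamma U.

Definition admissible (R : realType) (d : nat) (gamma : R) :
    set (state R d) :=
  [set U | 0 < rho U /\ 0 < pressure gamma U].

Definition conv_flux (R : realType) (d : nat) (gamma : R) (l : 'I_d)
    (U : state R d) : state R d :=
  mkstate (rho U * velocity U l 0)
    (velocity U l 0 *: momentum U + pressure gamma U *: delta_mx l 0)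
    ((energy U + pressure gamma U) * velocity U l 0).

Definition Zvars (R : realType) (d : nat) (gamma : R) (U : state R d) :
  state R d := mkstate 0 (velocity U) (temperature gamma U).

(* Column m is the approximation of the m-th partial derivative of Z. *)
Notation gradZ R d := ('M[R]_(1 + (d + 1), d)).

(* G k m approximates the m-th partial derivative of the velocity u_k. *)
Definition grad_velocity (R : realType) (d : nat) (S : gradZ R d) : 'M[R]_d :=
  usubmx (dsubmx S).

Definition grad_temperature (R : realType) (d : nat) (S : gradZ R d) :
  'cV[R]_d := (dsubmx (dsubmx S))^T.

Definition stress (R : realType) (d : nat) (mu : R) (S : gradZ R d) :
    'M[R]_d :=
  let G := grad_velocity S in mu *: (G + G^T - (2 / 3 * \tr G)%:M).

Definition conductivity (R : realType) (gamma mu Pr : R) : R :=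
  gamma * mu / ((gamma - 1) * Pr).

Definition heat_flux (R : realType) (d : nat) (gamma mu Pr : R)
    (S : gradZ R d) : 'cV[R]_d :=
  - conductivity gamma mu Pr *: grad_temperature S.

Definition visc_flux (R : realType) (d : nat) (gamma mu Pr : R) (l : 'I_d)
    (U : state R d) (S : gradZ R d) : state R d :=
  let tau := col l (stress mu S) in
  mkstate 0 tau (dot (velocity U) tau - heat_flux gamma mu Pr S l 0).

Definition visc_speed (R : realType) (d : nat) (gamma mu Pr : R) (l : 'I_d)
    (U : state R d) (S : gradZ R d) : R :=
  let tau := col l (stress mu S) in
  let q := heat_flux gamma mu Pr S l 0 in
  let r := rho U in
  let e := internal_energy U in
  (Num.sqrt (r ^+ 2 * q ^+ 2 + 2 * r ^+ 2 * e * sqnorm tau) + r * `|q|)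
    / (2 * r ^+ 2 * e).

Notation cell d := ('rV[int]_d).

Definition unit_cell (d : nat) (l : 'I_d) : cell d := delta_mx 0 l.

Definition discrete_grad (R : realType) (d : nat) (gamma : R) (dx : 'I_d -> R)
    (Ubar : cell d -> state R d) (i : cell d) : gradZ R d :=
  \matrix_(k, m) ((Zvars gamma (Ubar (i + unit_cell m)) k 0
                   - Zvars gamma (Ubar (i - unit_cell m)) k 0) / (2 * dx m)).

Definition cell_flux (R : realType) (d : nat) (gamma mu Pr : R)
    (dx : 'I_d -> R) (Ubar : cell d -> state R d) (l : 'I_d) (i : cell d) :
    state R d :=
  conv_flux gamma l (Ubar i)
  - visc_flux gamma mu Pr l (Ubar i) (discrete_grad gamma dx Ubar i).

(* Quantities attached to the face i + e_l / 2 (alpha, beta, lambda and the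
   numerical flux) are indexed by l and the cell i; the face i - e_l / 2 is
   the one with cell index i - e_l. *)
Definition low_flux (R : realType) (d : nat) (gamma mu Pr : R)
    (dx : 'I_d -> R) (Ubar : cell d -> state R d)
    (lambda : 'I_d -> cell d -> R) (l : 'I_d) (i : cell d) : state R d :=
  2^-1 *: (cell_flux gamma mu Pr dx Ubar l i
           + cell_flux gamma mu Pr dx Ubar l (i + unit_cell l))
  - (lambda l i / 2) *: (Ubar (i + unit_cell l) - Ubar i).

(* The maximum over the infinite mesh is rendered by [sup].  If lambda l is
   unbounded then [sup] is 0 and so is the quotient, in agreement with
   1 / +oo = 0, so that no positive time step is below the bound. *)
Definition cfl_bound (R : realType) (d : nat) (dx : 'I_d -> R)
    (lambda : 'I_d -> cell d -> R) : R :=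
  inf (range (fun l : 'I_d => dx l / (2 * d%:R * sup (range (lambda l))))).

Definition state_plus (R : realType) (d : nat) (gamma mu Pr : R)
    (dx : 'I_d -> R) (dt : R) (Ubar : cell d -> state R d)
    (lambda : 'I_d -> cell d -> R) (l : 'I_d) (i : cell d) : state R d :=
  Ubar i - (2 * d%:R * (dt / dx l)) *:
    (low_flux gamma mu Pr dx Ubar lambda l i
     - cell_flux gamma mu Pr dx Ubar l i).

Definition state_minus (R : realType) (d : nat) (gamma mu Pr : R)
    (dx : 'I_d -> R) (dt : R) (Ubar : cell d -> state R d)
    (lambda : 'I_d -> cell d -> R) (l : 'I_d) (i : cell d) : state R d :=
  Ubar i - (2 * d%:R * (dt / dx l)) *:
    (cell_flux gamma mu Pr dx Ubar l i
     - low_flux gamma mu Pr dx Ubar lambda l (i - unit_cell l)).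

(* Main.v *)
Require Import Defs.
From mathcomp Require Import all_boot all_order all_algebra.
From mathcomp Require Import all_classical reals.
From mathcomp Require Import ring lra.

(** Write [theta = 2 d r_l], [F] for the flux at [i], and [G] for the flux at
    the neighbour [V] of [U].  The intermediate state across the upper face is

      [U^+ = (1 - theta lambda) U + theta/2 (lambda U + F)
                                  + theta/2 (lambda V - G)],

    and the one across the lower face has the same form with the signs of
    [F] and [G] reversed.  The time step restriction gives [theta lambda <= 1]
    ([cfl_step]), so it suffices that the admissible set is a convex cone
    and that [lambda U + s F] lies in it for [s = 1] and [s = -1]
    ([half_update_admissible]).

    The cone property ([admissibleD], [admissibleZ]) comes from replacing the
    nonlinear positivity of the pressure by a family of linear inequalities:
    the energy seen from every frame moving at constant velocity is positive
    ([admissibleP]).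

    Since [lambda = alpha + beta], the state [lambda U + s F] splits as
    [(alpha U + s F^c) + (beta U - s F^v)].  Both summands are a positive
    multiple of [U] plus a state without mass: a momentum increment [w] and an
    energy increment that is the work [u . w] plus some [h].  The work cancels
    the cross term of the kinetic energy, so the internal energy density of
    such a sum is [k rho e + h - |w|^2 / (2 k rho)] ([admissible_perturb]).
    - For the convective part, [k = alpha + s u_l >= c], [w] is the pressure
      force and [h = 0]; positivity reduces to [p^2 < 2 rho^2 e c^2], that is
      to [gamma - 1 < 2 gamma].
    - For the viscous part, [k = beta], [w = - s tau_l] and [h = s q_l]; in
      the worst case [s q_l = - |q_l|] positivity is a quadratic inequality
      in [beta], and [b_l] is exactly its larger root. *)

Set Implicit Arguments.
Unset Strict Implicit.

Import Order.TTheory GRing.Theory Num.Theory.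
Local Open Scope ring_scope.

(** * Preliminaries on signs, dot products and states *)

Lemma norm1_sqr (R : realType) (s : R) : `|s| = 1 -> s ^+ 2 = 1.
Proof. by move=> s1; rewrite -real_normK ?num_real // s1 expr1n. Qed.

Lemma norm1_mul_ge (R : realType) (x s : R) : `|s| = 1 -> - `|x| <= s * x.
Proof.
by move=> s1; rewrite lerNl -[`|x|]mul1r -s1 -normrM ler_normr lexx orbT.
Qed.

Lemma dotC (R : realType) (d : nat) (v w : 'cV[R]_d) : dot v w = dot w v.
Proof. by apply: eq_bigr => k _; rewrite mulrC. Qed.

Lemma dotDl (R : realType) (d : nat) (v v' w : 'cV[R]_d) :
  dot (v + v') w = dot v w + dot v' w.
Proof.
by rewrite /dot -big_split; apply: eq_bigr => k _; rewrite mxE mulrDl.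
Qed.

Lemma dotZl (R : realType) (d : nat) (a : R) (v w : 'cV[R]_d) :
  dot (a *: v) w = a * dot v w.
Proof. by rewrite /dot mulr_sumr; apply: eq_bigr => k _; rewrite mxE mulrA. Qed.

Lemma dotDr (R : realType) (d : nat) (v w w' : 'cV[R]_d) :
  dot v (w + w') = dot v w + dot v w'.
Proof. by rewrite dotC dotDl !(dotC v). Qed.

Lemma dotZr (R : realType) (d : nat) (a : R) (v w : 'cV[R]_d) :
  dot v (a *: w) = a * dot v w.
Proof. by rewrite dotC dotZl dotC. Qed.

Lemma dot_delta (R : realType) (d : nat) (v : 'cV[R]_d) (l : 'I_d) :
  dot v (delta_mx l 0) = v l 0.
Proof.
rewrite /dot (bigD1 l) //= mxE !eqxx mulr1 big1 ?addr0 // => k kl.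
by rewrite mxE (negbTE kl) mulr0.
Qed.

Lemma sqnormD (R : realType) (d : nat) (v w : 'cV[R]_d) :
  sqnorm (v + w) = sqnorm v + 2 * dot v w + sqnorm w.
Proof. by rewrite /sqnorm !dotDl !dotDr (dotC w v); ring. Qed.

Lemma sqnormZ (R : realType) (d : nat) (a : R) (v : 'cV[R]_d) :
  sqnorm (a *: v) = a ^+ 2 * sqnorm v.
Proof. by rewrite /sqnorm dotZl dotZr; ring. Qed.

Lemma sqnorm_ge0 (R : realType) (d : nat) (v : 'cV[R]_d) : 0 <= sqnorm v.
Proof. by apply: sumr_ge0 => k _; rewrite -expr2 sqr_ge0. Qed.

Lemma rhoD (R : realType) (d : nat) (U V : state R d) :
  rho (U + V) = rho U + rho V.
Proof. by rewrite /rho !mxE. Qed.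

Lemma rhoZ (R : realType) (d : nat) (a : R) (U : state R d) :
  rho (a *: U) = a * rho U.
Proof. by rewrite /rho !mxE. Qed.

Lemma momentumD (R : realType) (d : nat) (U V : state R d) :
  momentum (U + V) = momentum U + momentum V.
Proof. by apply/colP => k; rewrite !mxE. Qed.

Lemma momentumZ (R : realType) (d : nat) (a : R) (U : state R d) :
  momentum (a *: U) = a *: momentum U.
Proof. by apply/colP => k; rewrite !mxE. Qed.

Lemma energyD (R : realType) (d : nat) (U V : state R d) :
  energy (U + V) = energy U + energy V.
Proof. by rewrite /energy !mxE. Qed.

Lemma energyZ (R : realType) (d : nat) (a : R) (U : state R d) :
  energy (a *: U) = a * energy U.
Proof. by rewrite /energy !mxE. Qed.

Lemma rho_mkstate (R : realType) (d : nat) (a b : R) (v : 'cV[R]_d) :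
  rho (mkstate a v b) = a.
Proof. by rewrite /rho col_mxKu mxE eqxx. Qed.

Lemma momentum_mkstate (R : realType) (d : nat) (a b : R) (v : 'cV[R]_d) :
  momentum (mkstate a v b) = v.
Proof. by rewrite /momentum col_mxKd col_mxKu. Qed.

Lemma energy_mkstate (R : realType) (d : nat) (a b : R) (v : 'cV[R]_d) :
  energy (mkstate a v b) = b.
Proof. by rewrite /energy !col_mxKd mxE eqxx. Qed.

Lemma mkstate_eta (R : realType) (d : nat) (U : state R d) :
  U = mkstate (rho U) (momentum U) (energy U).
Proof. by rewrite /mkstate /rho /energy -!mx11_scalar !vsubmxK. Qed.

Lemma state_eq (R : realType) (d : nat) (U V : state R d) :
  rho U = rho V -> momentum U = momentum V -> energy U = energy V -> U = V.
Proof.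
by move=> hr hm hE; rewrite (mkstate_eta U) hr hm hE -mkstate_eta.
Qed.

(** * The admissible set is a convex cone *)

(** Total energy of [U] observed in the frame that moves with velocity [v]. *)
Definition boosted_energy (R : realType) (d : nat) (U : state R d)
    (v : 'cV[R]_d) : R :=
  energy U - dot (momentum U) v + rho U * sqnorm v / 2.

(** The boosted energy is a convex quadratic function of [v] whose minimum,
    at the fluid velocity, is the internal energy density.  The gain over the
    definition is that each of these conditions is linear in [U]. *)
Lemma admissibleP (R : realType) (d : nat) (gamma : R) (U : state R d) :
  1 < gamma ->
  admissible gamma U <-> 0 < rho U /\ forall v, 0 < boosted_energy U v.
Proof.
move=> g1; have g0 : 0 < gamma - 1 by rewrite subr_gt0.
rewrite /admissible /pressure /=.
split=> -[r0 h]; split=> //.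
  move=> v; rewrite /boosted_energy; move: h; rewrite pmulr_rgt0 // => h.
  (* Complete the square: the remainder is [rho |v - m / rho|^2 / 2]. *)
  have := sqnorm_ge0 (v + (- (rho U)^-1) *: momentum U).
  rewrite sqnormD sqnormZ dotZr (dotC _ v) => sq0.
  have -> : energy U - dot v (momentum U) + rho U * sqnorm v / 2 =
    (energy U - sqnorm (momentum U) / (2 * rho U)) + rho U / 2 *
      (sqnorm v + 2 * (- (rho U)^-1 * dot v (momentum U))
       + (- (rho U)^-1) ^+ 2 * sqnorm (momentum U)).
    by field; rewrite gt_eqF.
  by apply: ltr_pwDl => //; apply: mulr_ge0 => //; rewrite divr_ge0 // ltW.
rewrite pmulr_rgt0 //; have := h ((rho U)^-1 *: momentum U).
rewrite /boosted_energy dotZr sqnormZ -/(sqnorm (momentum U)); congr (0 < _).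
by field; rewrite gt_eqF.
Qed.

Lemma admissibleD (R : realType) (d : nat) (gamma : R) (U V : state R d) :
  1 < gamma -> admissible gamma U -> admissible gamma V ->
  admissible gamma (U + V).
Proof.
move=> g1 /(admissibleP _ g1)[rU hU] /(admissibleP _ g1)[rV hV].
apply/(admissibleP _ g1); split=> [|v]; first by rewrite rhoD addr_gt0.
have := addr_gt0 (hU v) (hV v); congr (0 < _).
by rewrite /boosted_energy rhoD energyD momentumD dotDl; ring.
Qed.

Lemma admissibleZ (R : realType) (d : nat) (gamma a : R) (U : state R d) :
  1 < gamma -> 0 < a -> admissible gamma U -> admissible gamma (a *: U).
Proof.
move=> g1 a0 /(admissibleP _ g1)[rU hU].
apply/(admissibleP _ g1); split=> [|v]; first by rewrite rhoZ mulr_gt0.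
have := mulr_gt0 a0 (hU v); congr (0 < _).
by rewrite /boosted_energy rhoZ energyZ momentumZ dotZl; ring.
Qed.

(** * Internal energy and perturbed states *)

Lemma internal_energyE (R : realType) (d : nat) (U : state R d) :
  rho U != 0 ->
  rho U * internal_energy U = energy U - sqnorm (momentum U) / (2 * rho U).
Proof.
by move=> r0; rewrite /internal_energy /velocity sqnormZ; field.
Qed.

Lemma internal_energy_gt0 (R : realType) (d : nat) (gamma : R)
    (U : state R d) :
  1 < gamma -> admissible gamma U -> 0 < internal_energy U.
Proof.
move=> g1 [r0]; rewrite pressureE ?gt_eqF //.
by rewrite pmulr_rgt0 ?subr_gt0 // pmulr_rgt0.
Qed.

(** Expanding [|k m + w|^2 / (2 k rho)] gives the cross term [m . w / rho],
    which is the work [u . w] contained in the energy increment; nothing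
    that depends on the velocity is left in the internal energy of the sum. *)
Lemma admissible_perturb (R : realType) (d : nat) (gamma k h : R)
    (U : state R d) (w : 'cV[R]_d) :
  1 < gamma -> 0 < rho U -> 0 < k ->
  sqnorm w < 2 * (k * rho U) * (k * rho U * internal_energy U + h) ->
  admissible gamma (k *: U + mkstate 0 w (dot (velocity U) w + h)).
Proof.
move=> g1 r0 k0 hw; rewrite /admissible /= /pressure.
rewrite rhoD rhoZ rho_mkstate addr0 momentumD momentumZ momentum_mkstate.
rewrite energyD energyZ energy_mkstate; split; first exact: mulr_gt0.
have kr0 : 0 < 2 * (k * rho U) by rewrite !mulr_gt0.
rewrite pmulr_rgt0 ?subr_gt0 // ltr_pdivrMr //.
move: hw; rewrite -(mulrA k (rho U) (internal_energy U)).
rewrite internal_energyE ?gt_eqF //.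
rewrite /velocity dotZl sqnormD sqnormZ dotZl.
rewrite -subr_gt0 => hw; rewrite -subr_gt0; move: hw; congr (0 < _).
move: (rho U) (energy U) r0 => r E r0.
move: (sqnorm w) (sqnorm (momentum U)) (dot (momentum U) w) => w2 m2 mw.
by field; rewrite gt_eqF.
Qed.

(** * The convective and viscous half states *)

(** Transport at the velocity [u_l] only rescales [U], and the pressure force
    contributes exactly its own work to the energy flux, so the claim becomes
    [p^2 < 2 k^2 rho^2 e] with [k = alpha + s u_l >= c]. *)
Lemma conv_flux_admissible (R : realType) (d : nat) (gamma alpha s : R)
    (l : 'I_d) (U : state R d) :
  1 < gamma -> `|s| = 1 -> admissible gamma U ->
  wave_speed gamma l U <= alpha ->
  admissible gamma (alpha *: U + s *: conv_flux gamma l U).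
Proof.
move=> g1 s1 aU; have [r0 p0] := aU.
have e0 := internal_energy_gt0 g1 aU.
rewrite /wave_speed /sound_speed => ha.
set u := velocity U l 0 in ha *; set p := pressure gamma U in p0 ha *.
have g0 : 0 < gamma by apply: lt_trans g1.
have c2 : 0 < gamma * p / rho U by rewrite divr_gt0 // mulr_gt0.
have su := norm1_mul_ge u s1.
set c := Num.sqrt _ in ha; have c0 : 0 < c by rewrite sqrtr_gt0.
have ck : c <= alpha + s * u.
  by move: ha su; move: (s * u) => x; lra.
have k0 : 0 < alpha + s * u by apply: lt_le_trans ck.
have -> : alpha *: U + s *: conv_flux gamma l U =
    (alpha + s * u) *: U
    + mkstate 0 ((s * p) *: delta_mx l 0)
        (dot (velocity U) ((s * p) *: delta_mx l 0) + 0).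
  apply: state_eq; rewrite ?(rhoD, rhoZ, momentumD, momentumZ, energyD, energyZ)
    ?(rho_mkstate, momentum_mkstate, energy_mkstate).
  - by rewrite -/u; ring.
  - by rewrite -/u -/p scalerDr !scalerA scalerDl addrA.
  - by rewrite dotZr dot_delta -/u -/p; ring.
apply: admissible_perturb => //.
rewrite sqnormZ {1}/sqnorm dot_delta mxE !eqxx mulr1 addr0 exprMn.
rewrite (norm1_sqr s1) mul1r.
have kc : gamma * p / rho U <= (alpha + s * u) ^+ 2.
  by rewrite -(sqr_sqrtr (ltW c2)) ler_pXn2r // nnegrE ltW.
have pE : p = (gamma - 1) * (rho U * internal_energy U).
  by rewrite /p pressureE ?gt_eqF.
have re0 := mulr_gt0 r0 e0.
(* Replace [(alpha + s u)^2] by its lower bound [c^2 = gamma p / rho]. *)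
apply: (@lt_le_trans _ _ (2 * rho U * (rho U * internal_energy U)
                          * (gamma * p / rho U))); last first.
  have -> : 2 * ((alpha + s * u) * rho U)
        * ((alpha + s * u) * rho U * internal_energy U) =
      2 * rho U * (rho U * internal_energy U) * (alpha + s * u) ^+ 2 by ring.
  by apply: ler_wpM2l kc; rewrite mulr_ge0 ?(ltW re0) // mulr_ge0 // ltW.
have -> : 2 * rho U * (rho U * internal_energy U) * (gamma * p / rho U)
   = 2 * gamma * (rho U * internal_energy U) * p by field; rewrite gt_eqF.
(* Both sides are multiples of [p rho e]; [gamma - 1 < 2 gamma] remains. *)
by rewrite expr2 ltr_pM2r // pE ltr_pM2r //; lra.
Qed.

Lemma visc_speed_ge0 (R : realType) (d : nat) (gamma mu Pr : R) (l : 'I_d)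
    (U : state R d) (S : gradZ R d) :
  0 < rho U -> 0 < internal_energy U ->
  0 <= visc_speed gamma mu Pr l U S.
Proof.
move=> r0 e0; rewrite /visc_speed divr_ge0 ?addr_ge0 ?sqrtr_ge0 //.
- by rewrite mulr_ge0 // ltW.
- by rewrite mulr_ge0 ?(ltW e0) // mulr_ge0 ?sqr_ge0.
Qed.

(** The stress enters the energy flux through its own work, and the heat flux
    is the remaining increment.  After the bound [s q_l >= - |q_l|] the claim is
    [|tau_l|^2 < 2 beta rho (beta rho e - |q_l|)], which holds beyond the
    larger root of the quadratic in [beta]. *)
Lemma visc_flux_admissible (R : realType) (d : nat) (gamma mu Pr beta s : R)
    (l : 'I_d) (U : state R d) (S : gradZ R d) :
  1 < gamma -> `|s| = 1 -> admissible gamma U ->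
  visc_speed gamma mu Pr l U S < beta ->
  admissible gamma (beta *: U - s *: visc_flux gamma mu Pr l U S).
Proof.
move=> g1 s1 aU; have [r0 _] := aU.
have e0 := internal_energy_gt0 g1 aU.
move=> hb; have b0 : 0 < beta.
  by apply: le_lt_trans hb; apply: visc_speed_ge0.
move: hb; rewrite /visc_speed /visc_flux.
set tau := col l _; set q := heat_flux _ _ _ _ _ _.
set r := rho U in r0 *; set e := internal_energy U in e0 *.
have D0 : 0 < 2 * r ^+ 2 * e by rewrite mulr_gt0 // mulr_gt0 // exprn_gt0.
rewrite ltr_pdivrMr // -ltrBrDr => hb.
have -> : beta *: U - s *: mkstate 0 tau (dot (velocity U) tau - q) =
    beta *: U + mkstate 0 (- s *: tau) (dot (velocity U) (- s *: tau) + s * q).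
  apply: state_eq; rewrite -scaleNr
    ?(rhoD, rhoZ, momentumD, momentumZ, energyD, energyZ)
    ?(rho_mkstate, momentum_mkstate, energy_mkstate) //.
  - by ring.
  - by rewrite dotZr; ring.
apply: admissible_perturb => //; rewrite -/r -/e sqnormZ sqrrN.
rewrite (norm1_sqr s1) mul1r.
have sq := norm1_mul_ge q s1.
apply: (@lt_le_trans _ _ (2 * (beta * r) * (beta * r * e - `|q|))); last first.
  by rewrite ler_pM2l ?mulr_gt0 // lerD2l.
have rhs0 : 0 <= beta * (2 * r ^+ 2 * e) - r * `|q|.
  by apply: le_trans (ltW hb); apply: sqrtr_ge0.
have D'0 : 0 <= r ^+ 2 * q ^+ 2 + 2 * r ^+ 2 * e * sqnorm tau.
  by rewrite addr_ge0 // mulr_ge0 ?sqr_ge0 ?sqnorm_ge0 // ltW.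
(* [hb] reads [sqrt (discriminant) < 2 rho^2 e beta - rho |q|]; squaring it and
   dividing by [2 rho^2 e] gives the quadratic inequality. *)
move: hb; rewrite -(@ltr_pXn2r _ 2) ?nnegrE ?sqrtr_ge0 // sqr_sqrtr //.
rewrite -[q ^+ 2]real_normK ?num_real // -subr_gt0 => hb.
by rewrite -(ltr_pM2l D0) -subr_gt0; move: hb; congr (0 < _); ring.
Qed.

(** * Time step and convex decomposition *)

(** A positive [dt] below the bound forces each [sup (range (lambda l))] to be
    nonzero, hence a genuine supremum that dominates every face. *)
Lemma cfl_step (R : realType) (d : nat) (dx : 'I_d -> R)
    (lambda : 'I_d -> cell d -> R) (dt : R) :
  (forall l, 0 < dx l) -> (forall l i, 0 < lambda l i) ->
  0 < dt -> dt <= cfl_bound dx lambda ->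
  forall l i, 2 * d%:R * (dt / dx l) * lambda l i <= 1.
Proof.
move=> dx0 lam0 dt0 hdt l i.
have d0 : 0 < d%:R :> R by rewrite ltr0n; apply: leq_ltn_trans (ltn_ord l).
have sup0 m : 0 <= sup (range (lambda m)).
  have [hs|/sup_out -> //] := pselect (has_sup (range (lambda m))).
  by apply: le_trans (ltW (lam0 m 0)) _; apply: (ub_le_sup hs.2); exists 0.
have hl : dt <= dx l / (2 * d%:R * sup (range (lambda l))).
  apply: le_trans hdt _; apply: ge_inf; last by exists l.
  exists 0 => _ [m _ <-]; apply: divr_ge0; first exact: ltW.
  by rewrite mulr_ge0 // mulr_ge0 // ltW.
have hs : has_sup (range (lambda l)).
  apply: contrapT => /sup_out s0.
  by move: hl; rewrite s0 mulr0 invr0 mulr0 leNgt dt0.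
have lam_le : lambda l i <= sup (range (lambda l)).
  by apply: (ub_le_sup hs.2); exists i.
have s_gt0 : 0 < sup (range (lambda l)) by apply: lt_le_trans lam_le.
move: hl; rewrite ler_pdivlMr ?mulr_gt0 // => hl.
have -> : 2 * d%:R * (dt / dx l) * lambda l i
    = dt * (2 * d%:R * lambda l i) / dx l by ring.
rewrite ler_pdivrMr // mul1r; apply: le_trans hl.
by rewrite ler_pM2l // ler_pM2l // mulr_gt0.
Qed.

(** The sign [s] treats both faces at once: it is [1] when [V] is the upper
    neighbour of [U] and [-1] when it is the lower one. *)
Lemma half_update_admissible (R : realType) (d : nat) (gamma theta lam s : R)
    (U V F G : state R d) :
  1 < gamma -> 0 < theta -> theta * lam <= 1 -> admissible gamma U ->
  admissible gamma (lam *: U + s *: F) ->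
  admissible gamma (lam *: V - s *: G) ->
  admissible gamma (U - theta *: (s *: (2^-1 *: (F + G))
                      - (lam / 2) *: (V - U) - s *: F)).
Proof.
move=> g1 th0 cfl aU aUF aVG.
have -> : U - theta *: (s *: (2^-1 *: (F + G)) - (lam / 2) *: (V - U) - s *: F)
  = (theta / 2) *: (lam *: U + s *: F) + (theta / 2) *: (lam *: V - s *: G)
    + (1 - theta * lam) *: U.
  by apply/colP => k; rewrite !mxE; field.
have th2 : 0 < theta / 2 by rewrite divr_gt0.
have a2 : admissible gamma ((theta / 2) *: (lam *: U + s *: F)
                            + (theta / 2) *: (lam *: V - s *: G)).
  by apply: admissibleD => //; apply: admissibleZ.
(* At [theta * lam = 1] the third summand is zero, which is not admissible. *)
have := cfl; rewrite le_eqVlt => /orP[/eqP ->|cfl'].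
  by rewrite subrr scale0r addr0.
by apply: admissibleD => //; apply: admissibleZ => //; rewrite subr_gt0.
Qed.

Unset Implicit Arguments.

Theorem proposition3p1 (R : realType) (d : nat) (hd : d = 1%N \/ d = 2%N)
    (gamma mu Pr : R) (hgamma : 1 < gamma) (hmu : 0 < mu) (hPr : 0 < Pr)
    (dx : 'I_d -> R) (hdx : forall l : 'I_d, 0 < dx l)
    (Ubar : cell d -> state R d)
    (hU : forall i : cell d, admissible gamma (Ubar i))
    (alpha beta lambda : 'I_d -> cell d -> R)
    (halpha : forall (i : cell d) (l : 'I_d),
       Num.max (wave_speed gamma l (Ubar i))
               (wave_speed gamma l (Ubar (i + unit_cell l)%R)) <= alpha l i)
    (hbeta : forall (i : cell d) (l : 'I_d),
       Num.max (visc_speed gamma mu Pr l (Ubar i)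
                  (discrete_grad gamma dx Ubar i))
               (visc_speed gamma mu Pr l (Ubar (i + unit_cell l)%R)
                  (discrete_grad gamma dx Ubar (i + unit_cell l)%R))
       < beta l i)
    (hlambda : forall (i : cell d) (l : 'I_d),
       lambda l i = alpha l i + beta l i)
    (dt : R) (hdt : 0 < dt) (hcfl : dt <= cfl_bound dx lambda) :
  forall (i : cell d) (l : 'I_d),
    admissible gamma (state_plus gamma mu Pr dx dt Ubar lambda l i) /\
    admissible gamma (state_minus gamma mu Pr dx dt Ubar lambda l i).
Proof.
have key s a b j l : `|s| = 1 -> wave_speed gamma l (Ubar j) <= a ->
    visc_speed gamma mu Pr l (Ubar j) (discrete_grad gamma dx Ubar j) < b ->
    admissible gamma ((a + b) *: Ubar j
                      + s *: cell_flux gamma mu Pr dx Ubar l j).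
  move=> s1 ha hb; rewrite scalerDl scalerBr addrACA.
  apply: admissibleD => //; first exact: conv_flux_admissible.
  exact: visc_flux_admissible.
have left s j l : `|s| = 1 -> admissible gamma
    (lambda l j *: Ubar j + s *: cell_flux gamma mu Pr dx Ubar l j).
  move=> s1; rewrite hlambda; apply: key => //.
  - by have := halpha j l; rewrite ge_max => /andP[].
  - by have := hbeta j l; rewrite gt_max => /andP[].
have right s j l : `|s| = 1 -> admissible gamma
    (lambda l j *: Ubar (j + unit_cell l)
     + s *: cell_flux gamma mu Pr dx Ubar l (j + unit_cell l)).
  move=> s1; rewrite hlambda; apply: key => //.
  - by have := halpha j l; rewrite ge_max => /andP[].
  - by have := hbeta j l; rewrite gt_max => /andP[].
have lam0 l i : 0 < lambda l i.
  rewrite hlambda ltr_wpDl //.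
    have := halpha i l; rewrite ge_max => /andP[h _].
    by apply: le_trans h; rewrite addr_ge0 // sqrtr_ge0.
  have := hbeta i l; rewrite gt_max => /andP[h _]; apply: le_lt_trans h.
  have aU := hU i.
  by apply: visc_speed_ge0; [case: aU|apply: internal_energy_gt0 aU].
have n1 : `|-1 : R| = 1 by rewrite normrN1.
move=> i l; have cfl := cfl_step hdx lam0 hdt hcfl l.
have d0 : 0 < d%:R :> R by rewrite ltr0n; apply: leq_ltn_trans (ltn_ord l).
have th0 : 0 < 2 * d%:R * (dt / dx l) by rewrite !mulr_gt0 ?invr_gt0.
split.
  have := right (-1) i l n1; have := left 1 i l (normr1 _).
  rewrite /state_plus /low_flux scaleN1r.
  move: (cell_flux _ _ _ _ _ _ i) (cell_flux _ _ _ _ _ _ (i + _)) => F G.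
  (* Write [- G] as [- s G] with [s = 1]. *)
  rewrite -[in X in _ -> X -> _](scale1r G) => aF aG.
  have := half_update_admissible hgamma th0 (cfl i) (hU i) aF aG.
  by rewrite !scale1r.
have := right (-1) (i - unit_cell l) l n1.
have := left 1 (i - unit_cell l) l (normr1 _).
rewrite /state_minus /low_flux subrK scale1r.
move: (cell_flux _ _ _ _ _ _ i) (cell_flux _ _ _ _ _ _ (i - _)) => F G.
(* Write [G] as [- s G] with [s = -1]. *)
rewrite -[in X in X -> _](opprK G) -(scaleN1r G) => aG aF.
have := half_update_admissible hgamma th0 (cfl (i - unit_cell l)) (hU i) aF aG.
congr (admissible _ (_ - _ *: _)).
by apply/colP => k; rewrite !mxE; ring.
Qed.
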